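(* Let $K$ be a field, let $m \ge n \ge 1$ be integers, let $\lambda=(\lambda_1,\dots,\lambda_n)$ be a partition with $m=\lambda_1\ge\lambda_2\ge\cdots\ge\lambda_n\ge 1$, and let $\mu=(\mu_1,\dots,\mu_n)\in\mathbb{Z}^n$ satisfy $0\le\mu_1\le\cdots\le\mu_n<\lambda_n$. If $\mu_i\ge i-1$ for $i=1,\dots,n$, then the cellular complex $\mathcal{F}_{\overline{X}_{\lambda-\mu}}$ of free modules over $S=K[x_1,\dots,x_m]$ provides the minimal free $\mathbb{Z}^m$-graded resolution of the specialization $\overline{I}_{\lambda-\mu}\subset S$ of the generalized Ferrers ideal $I_{\lambda-\mu}$.
   Context: **Ideals.** Let $R=K[x_1,\dots,x_n,y_1,\dots,y_m]$ and $S=K[x_1,\dots,x_m]$ (with $m\ge n$). The generalized Ferrers ideal is $I_{\lambda-\mu}:=(x_iy_j \mid 1\le i\le n,\ \mu_i<j\le\lambda_i)\subset R$. The specialization map $\sigma\colon R\to S$ is the $K$-algebra homomorphism with $\sigma(x_i)=x_i$ and $\sigma(y_j)=x_j$. The specialization of $I_{\lambda-\mu}$ is the monomial ideal $\overline{I}_{\lambda-\mu}:=\sigma(I_{\lambda-\mu})\subset S$, i.e. the ideal generated by the monomials $x_ix_j$ with $1\le i\le n$, $\mu_i<j\le\lambda_i$. **Cellular complexes.** A polyhedral cell complex $X$ is a finite collection of convex polytopes (faces), closed under taking faces, such that any two of them intersect in a common face. $F_k(X)$ denotes the set of $k$-dimensional faces; the empty face is included. Choose an incidence function $\varepsilon$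 on $X$ (with values $\pm1$ on pairs consisting of a face and one of its facets, defining the usual cellular boundary map). $X$ is labeled if each vertex $i$ carries a monomial $\mathbf{z}^{\mathbf{a}_i}$ in a polynomial ring $A=K[z_1,\dots,z_N]$; a face $Q$ then gets as label $\mathbf{z}^{\mathbf{a}_Q}$, the least common multiple of the labels of its vertices (the empty face has label $1$). The cellular complex $\mathcal{F}_X$ is the complex of $\mathbb{Z}^N$-graded free $A$-modules $$0\to A^{F_d(X)}\xrightarrow{\partial_d}\cdots\xrightarrow{\partial_1}A^{F_0(X)}\xrightarrow{\partial_0}A\to 0,$$ where $d=\dim X$, $A^{F_k(X)}=\bigoplus_{P\in F_k(X)}A[-\mathbf{a}_P]$ has basis $\{e_P\}$, and $\partial_k(e_P)=\sum_{Q\text{ facet of }P}\varepsilon(P,Q)\,\mathbf{z}^{\mathbf{a}_P-\mathbf{a}_Q}e_Q$, with $e_\emptyset=1$. When $\mathcal{F}_X$ is acyclic (exact except at the last term $A$), it provides a free $\mathbb{Z}^N$-graded resolution of the image of $\partial_0$, which is the ideal generated by the vertex labels. **The complexes $X_{\lambda-\mu}$ and $\overline{X}_{\lambda-\mu}$.** Let $X_{n,m}$ be the face complex of the polytope $\Delta_{n-1}\times\Delta_{m-1}$ (product of an $(n-1)$-simplex with vertices labeled $x_1,\dots,x_n$ and an $(m-1)$-simplex with vertices labeled $y_1,\dots,y_m$), whose vertices are labeled by the monomials $x_iy_j$. $X_{\lambda-\mu}$ is the labeled subcomplex consisting of all faces of $X_{n,m}$ all of whose vertices are labeled by monomials in $I_{\lambda-\mu}$.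 $\overline{X}_{\lambda-\mu}$ is the same cell complex as $X_{\lambda-\mu}$, with the vertex label $x_iy_j$ replaced by its specialization $x_ix_j$ (and face labels the corresponding least common multiples). *)

(* Defs.v *)
From HB Require Import structures.
From mathcomp Require Import all_boot all_order all_algebra.
From mathcomp.multinomials Require Import mpoly.

Set Implicit Arguments.
Unset Strict Implicit.
Unset Printing Implicit Defensive.

Import GRing.Theory.
Local Open Scope ring_scope.

Definition ideal_gen (A : comPzRingType) (I : finType) (P : {pred I}) (g : I -> A)
    (f : A) : Prop :=
  exists c : I -> A, f = \sum_(i in P) c i * g i.

Section MultigradedModules.
Variables (K : fieldType) (N : nat).
Local Notation S := {mpoly K[N]}.

(* [a] records the degrees of the basis of the free module
   \bigoplus_p S[- a p], whose elements are row vectors.  The component of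
   degree b of S[- a p] is spanned by the monomial of exponent b - a p.  As the
   a p are nonnegative, components of degree outside N^N are zero, so that it
   is enough to let b range over N^N. *)
Definition homogeneous r (a : 'I_r -> 'X_{1..N}) (b : 'X_{1..N}) (v : 'rV[S]_r)
    : Prop :=
  forall p u, u \in msupp (v 0 p) -> (a p + u)%MM = b.

(* Matrices act on row vectors from the right. *)
Definition graded_map r s (a : 'I_r -> 'X_{1..N}) (a' : 'I_s -> 'X_{1..N})
    (M : 'M[S]_(r, s)) : Prop :=
  forall b v, homogeneous a b v -> homogeneous a' b (v *m M).

(* The maps ... -> F_1 -> F_0 -> S, the last one being [gc_aug]. *)
Record graded_complex := GradedComplex {
  gc_rank : nat -> nat;
  gc_deg : forall k, 'I_(gc_rank k) -> 'X_{1..N};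
  gc_diff : forall k, 'M[S]_(gc_rank k.+1, gc_rank k);
  gc_aug : 'M[S]_(gc_rank 0, 1)
}.

Definition is_graded (F : graded_complex) : Prop :=
  (forall k, graded_map (@gc_deg F k.+1) (@gc_deg F k) (gc_diff F k)) /\
  graded_map (@gc_deg F 0) (fun=> 0%MM) (gc_aug F).

Definition is_acyclic (F : graded_complex) : Prop :=
  (forall k (v : 'rV_(gc_rank F k.+1)),
     v *m gc_diff F k = 0 <-> exists w, v = w *m gc_diff F k.+1) /\
  (forall v : 'rV_(gc_rank F 0),
     v *m gc_aug F = 0 <-> exists w, v = w *m gc_diff F 0).

Definition aug_image (F : graded_complex) (f : S) : Prop :=
  exists v : 'rV_(gc_rank F 0), f = (v *m gc_aug F) 0 0.

(* The image of F_(k+1) lies in (x_1, ..., x_N) F_k; the augmentation is not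
   concerned, as it maps F_0 onto the resolved ideal. *)
Definition is_minimal (F : graded_complex) : Prop :=
  forall k (v : 'rV_(gc_rank F k.+1)) p, ((v *m gc_diff F k) 0 p)@_0%MM = 0.

Definition minimal_graded_free_resolution (F : graded_complex) (I : S -> Prop)
    : Prop :=
  [/\ is_graded F, is_acyclic F, forall f, aug_image F f <-> I f
    & is_minimal F].

End MultigradedModules.

(* A face is identified with its set of vertices; [set0] is the empty face.
   [frank] is the dimension plus one, so that the empty face has rank 0. *)
Record cell_complex (V : finType) := CellComplex {
  face : {set {set V}};
  frank : {set V} -> nat
}.

Section CellularComplex.
Variables (V : finType) (X : cell_complex V).

Definition facet (P Q : {set V}) : bool :=
  [&& P \in face X, Q \in face X, Q \proper P & frank X P == (frank X Q).+1].

Definition incidence_function (eps : {set V} -> {set V} -> int) : Prop :=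
  (forall P Q, facet P Q -> eps P Q = 1 \/ eps P Q = -1) /\
  (forall P R, \sum_(Q | facet P Q && facet Q R) eps P Q * eps Q R = 0).

(* The subcomplex of the faces all of whose vertices are in W. *)
Definition induced_subcomplex (W : {set V}) : cell_complex V :=
  CellComplex [set Q in face X | Q \subset W] (frank X).

Definition faces_of_rank (k : nat) : {set {set V}} :=
  [set Q in face X | frank X Q == k].

Variables (K : fieldType) (N : nat) (label : V -> 'X_{1..N}).
Variable eps : {set V} -> {set V} -> int.

Definition face_label (Q : {set V}) : 'X_{1..N} :=
  \big[@mlcm N/0%MM]_(v in Q) label v.

Definition boundary_coef (P Q : {set V}) : {mpoly K[N]} :=
  if facet P Q then (eps P Q)%:~R *: 'X_[(face_label P - face_label Q)%MM]
  else 0.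

(* The term of index k has basis the faces of dimension k, i.e., of rank k.+1.
   The last free module, spanned by the empty face, is identified with S. *)
Definition cellular_complex : graded_complex K N :=
  @GradedComplex K N
    (fun k => #|faces_of_rank k.+1|)
    (fun k p => face_label (enum_val p))
    (fun k => \matrix_(p, q) boundary_coef (enum_val p) (enum_val q))
    (\matrix_(p, q) boundary_coef (enum_val p) set0).

End CellularComplex.

(* The face complex of the product of two simplices: the nonempty faces are the
   products A x B of nonempty faces of each simplex, with
   dim (A x B) = (#|A| - 1) + (#|B| - 1). *)
Definition product_of_simplices (n m : nat) : cell_complex ('I_n * 'I_m)%type :=
  CellComplex [set setX A B | A in [set: {set 'I_n}], B in [set: {set 'I_m}]]
    (fun Q => (#|[set v.1 | v in Q]| + #|[set v.2 | v in Q]|).-1).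

(* Indices are 0-based: the pair (i, j) stands for the monomial usually written
   x_(i+1) y_(j+1), so that mu_(i+1) < j + 1 <= lam_(i+1) reads
   mu i <= j < lam i. *)
Section Ferrers.
Variables (K : fieldType) (n m : nat).
Variables (lam mu : 'I_n -> nat).

Definition skew_shape : {set 'I_n * 'I_m} :=
  [set v : 'I_n * 'I_m | mu v.1 <= v.2 < lam v.1]%N.

(* In K[x_1, ..., x_n, y_1, ..., y_m] the first n variables are the x_i. *)
Definition xy_label (v : 'I_n * 'I_m) : 'X_{1..n + m} :=
  (U_(lshift m v.1) + U_(rshift n v.2))%MM.

Definition ferrers_ideal : {mpoly K[n + m]} -> Prop :=
  ideal_gen (mem skew_shape) (fun v => 'X_[xy_label v]).

(* The vertices whose label is in the ideal are exactly those in the shape. *)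
Lemma xy_label_in_ferrers_ideal (v : 'I_n * 'I_m) :
  ferrers_ideal 'X_[xy_label v] <-> v \in skew_shape.
Proof.
split=> [[c /(congr1 (mcoeff (xy_label v)))] | v_in]; last first.
  exists (fun w => (w == v)%:R); rewrite (bigD1 v) //= eqxx mul1r.
  by rewrite big1 ?addr0 // => w /andP[_ /negPf->]; rewrite mul0r.
rewrite mcoeffX eqxx raddf_sum /= => sum1; apply: contraT => v_out.
have/eqP[] := oner_neq0 K; rewrite [LHS]sum1 big1 // => w w_in.
apply: memN_msupp_eq0; apply: contra v_out.
rewrite (perm_mem (msuppMX _ _)) => /mapP[u _ def_v].
suff -> : v = w by [].
have lecoef i : (xy_label w i <= xy_label v i)%N by rewrite def_v mnmDE leq_addr.
case: v w {w_in sum1 def_v} lecoef => [i j] [i' j'] lecoef; congr (_, _).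
  have := lecoef (lshift m i'); rewrite !mnmDE !mnm1E eqxx eq_lshift !eq_rlshift.
  by case: eqP => /= [->|].
have := lecoef (rshift n j'); rewrite !mnmDE !mnm1E eqxx eq_rshift !eq_lrshift.
by case: eqP => /= [->|].
Qed.

Definition ferrers_complex : cell_complex ('I_n * 'I_m)%type :=
  induced_subcomplex (product_of_simplices n m) skew_shape.

Hypothesis le_nm : (n <= m)%N.

Definition specialization (f : {mpoly K[n + m]}) : {mpoly K[m]} :=
  f \mPo [tuple match split k with
                | inl i => 'X_(widen_ord le_nm i)
                | inr j => 'X_j
                end | k < n + m].

Definition specialized_label (v : 'I_n * 'I_m) : 'X_{1..m} :=
  (U_(widen_ord le_nm v.1) + U_(v.2))%MM.

Lemma specialization_xy_label v :
  specialization 'X_[xy_label v] = 'X_[specialized_label v].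
Proof.
rewrite /specialization mpolyXD rmorphM /= !comp_mpolyXU -!tnth_nth !tnth_mktuple.
by rewrite mpolyXD (unsplitK (inl _ v.1)) (unsplitK (inr _ v.2)).
Qed.

Definition specialized_ideal (f : {mpoly K[m]}) : Prop :=
  exists2 g, ferrers_ideal g & f = specialization g.

End Ferrers.

(* Main.v *)
(* A face of degree dividing b is a face all of whose vertices have labels
   dividing x^b, so exactness can be checked, one degree b at a time, over K, on
   the subcomplex induced by the set W of these vertices. Let r be the first row
   that meets W. As i <= mu_i, the entries of a row i > r lie in columns j > r,
   so that replacing (i, j) by (r, j) stays off the diagonal; hence (r, j) is in
   W whenever (i, j) is. Consequently A x B -> (r + A) x B, followed by
   {r} x B -> {r} x (c + B) for some (r, c) in W, matches all the faces in
   pairs, and eliminating matched pairs kills every cycle, whatever the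
   incidence function. *)
Require Import Defs.
From mathcomp Require Import all_boot all_order all_algebra.
From mathcomp.multinomials Require Import mpoly.

Set Implicit Arguments.
Unset Strict Implicit.
Unset Printing Implicit Defensive.

Import GRing.Theory.
Local Open Scope ring_scope.

(** * Eliminating matched pairs from a chain complex over a field *)

(** The last condition on [up] makes the incidence block from [D :\: L] to [L] monomial: for a chain
    [u] supported in [D :\: L], the boundary at [R] in [L] is the single term
    [u (up R) * d (up R) R]. Hence [w] can be chosen on [up @: L] so that its boundary agrees with
    [z] on [L]. The remainder [y] is a cycle vanishing on [L], and its boundary at [R] forces
    [y (up R) = 0]. *)
Lemma matching_elimination (K : fieldType) (T : finType) (d : T -> T -> K)
    (rk : T -> nat) (D L : {set T}) (up : T -> T) (k : nat) (z : T -> K) :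
    (forall P Q, d P Q != 0 -> rk P = (rk Q).+1) ->
    (forall P R, \sum_Q d P Q * d Q R = 0) ->
    (forall P Q, P \in D -> d P Q != 0 -> Q \in D) ->
    (forall Q, Q \in L -> up Q \in D :\: L) ->
    (forall Q, Q \in L -> d (up Q) Q != 0) ->
    {in L &, injective up} ->
    (forall P Q, P \in D :\: L -> Q \in L -> d P Q != 0 -> P = up Q) ->
    (forall P, z P != 0 -> P \in D /\ rk P = k) ->
    (forall Q, \sum_P z P * d P Q = 0) ->
  exists2 w : T -> K, forall P, w P != 0 -> P \in D /\ rk P = k.+1
  & exists y : T -> K,
    [/\ forall P, y P != 0 -> P \in D :\: L :\: up @: L /\ rk P = k,
        forall Q, \sum_P y P * d P Q = 0
      & forall P, z P = y P + \sum_Q w Q * d Q P].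
Proof.
move=> rk_d dd0 closedD up_in up_nz up_inj up_uniq zD dz.
(* As [up] is injective on [L], the sum has at most one term; it is a sum only to avoid an inverse
   of [up]. *)
pose w P := \sum_(Q in L | up Q == P) z Q / d P Q.
pose y P := z P - \sum_Q w Q * d Q P.
have wP P : w P != 0 -> exists Q, [/\ Q \in L, up Q = P & z Q != 0].
  move=> wP0; have [Q /and3P[QL /eqP upQ zQ]|none] :=
    pickP (fun Q => [&& Q \in L, up Q == P & z Q != 0]); first by exists Q.
  case/eqP: wP0; apply: big1 => Q /andP[QL upQ].
  by move: (none Q); rewrite QL upQ /= => /negbFE/eqP->; rewrite mul0r.
have w_up Q : Q \in L -> w (up Q) = z Q / d (up Q) Q.
  move=> QL; rewrite /w (bigD1 Q) ?QL //= big1 ?addr0 // => R.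
  by case/andP=> /andP[RL /eqP/up_inj-> //] /eqP.
have wD P : w P != 0 -> P \in D :\: L /\ rk P = k.+1.
  case/wP=> Q [QL <- /zD[_ <-]]; split; first exact: up_in.
  exact/rk_d/up_nz.
have sum_at R (u : T -> K) : R \in L -> (forall P, u P != 0 -> P \in D :\: L) ->
    \sum_P u P * d P R = u (up R) * d (up R) R.
  move=> RL uD; rewrite (bigD1 (up R)) //= big1 ?addr0 // => P neP.
  apply: contraNeq neP; rewrite mulf_eq0 negb_or => /andP[/uD PD dPR].
  exact/eqP/up_uniq.
have yL R : R \in L -> y R = 0.
  move=> RL; rewrite /y sum_at // => [|P /wD[]//].
  by rewrite w_up // divfK ?subrr // up_nz.
have yD P : y P != 0 -> P \in D :\: L /\ rk P = k.
  move=> yP; have PL : P \notin L by apply: contra yP => /yL->.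
  rewrite inE PL /=; have [/eqP zP|/zD//] := boolP (z P == 0).
  (* Here [z P = 0], so [P] comes from the boundary of some [Q] in the support of [w], which fixes
     its rank. *)
  have [Q /andP[wQ dQP]|none] := pickP (fun Q => (w Q != 0) && (d Q P != 0)).
    have [/setDP[QD _] rkQ] := wD _ wQ; split; first exact: closedD dQP.
    by apply: succn_inj; rewrite -(rk_d _ _ dQP).
  case/eqP: yP; rewrite /y zP big1 ?subrr // => Q _; apply/eqP.
  by rewrite mulf_eq0 -[_ || _]negbK negb_or none.
have dy R : \sum_P y P * d P R = 0.
  under eq_bigr => P _ do rewrite mulrBl.
  rewrite sumrB dz sub0r; apply/eqP; rewrite oppr_eq0; apply/eqP.
  under eq_bigr => P _ do rewrite mulr_suml.
  rewrite exchange_big big1 // => Q _.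
  under eq_bigr => P _ do rewrite -mulrA.
  by rewrite -mulr_sumr dd0 mulr0.
exists w; first by move=> P /wD[/setDP[]].
exists y; split=> // [P yP|P]; last by rewrite subrK.
have [PD ->] := yD _ yP; split=> //; rewrite !inE in PD *; rewrite {}PD andbT.
apply: contra yP => /imsetP[R RL ->].
have := dy R; rewrite sum_at // => [/eqP|P' /yD[]//].
by rewrite mulf_eq0 (negPf (up_nz _ RL)) orbF.
Qed.

(** * Faces of a product of two simplices *)

Lemma mem_setX (I J : finType) (A : {set I}) (B : {set J}) v :
  (v \in setX A B) = (v.1 \in A) && (v.2 \in B).
Proof. by case: v => i j; rewrite in_setX. Qed.

Section ProductFaces.
Variables (n m : nat).
Implicit Types (P Q Y W : {set 'I_n * 'I_m}) (A : {set 'I_n}) (B : {set 'I_m}).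
Local Notation rows Q := [set v.1 | v in Q].
Local Notation cols Q := [set v.2 | v in Q].

Lemma rows_setX A B : B != set0 -> rows (setX A B) = A.
Proof.
case/set0Pn=> j jB; apply/setP=> i; apply/imsetP/idP=> [[v]|iA].
  by rewrite mem_setX => /andP[vA _] ->.
by exists (i, j); rewrite ?mem_setX ?iA.
Qed.

Lemma cols_setX A B : A != set0 -> cols (setX A B) = B.
Proof.
case/set0Pn=> i iA; apply/setP=> j; apply/imsetP/idP=> [[v]|jB].
  by rewrite mem_setX => /andP[_ vB] ->.
by exists (i, j); rewrite ?mem_setX ?iA.
Qed.

Lemma setX0r A : setX A set0 = set0 :> {set 'I_n * 'I_m}.
Proof. by apply/setP=> v; rewrite mem_setX !inE andbF. Qed.

Lemma setX0l B : setX set0 B = set0 :> {set 'I_n * 'I_m}.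
Proof. by apply/setP=> v; rewrite mem_setX !inE. Qed.

Lemma rows_eq0 Q : (rows Q == set0) = (Q == set0).
Proof. exact: imset_eq0. Qed.

Lemma cols_eq0 Q : (cols Q == set0) = (Q == set0).
Proof. exact: imset_eq0. Qed.

(** The factors of a nonempty face are its projections. If one factor is empty the face is [set0],
    whose projections are both empty, so the equation persists. *)
Lemma face_product Q :
  (Q \in face (product_of_simplices n m)) = (Q == setX (rows Q) (cols Q)).
Proof.
apply/imset2P/eqP=> [[A B _ _ defQ]|->]; last by exists (rows Q) (cols Q).
have [A0|A0] := eqVneq A set0.
  by rewrite defQ A0 setX0l !imset0 setX0l.
have [B0|B0] := eqVneq B set0.
  by rewrite defQ B0 setX0r !imset0 setX0r.
by rewrite {1}defQ {1}defQ rows_setX // defQ cols_setX.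
Qed.

Lemma setX_in_product A B : setX A B \in face (product_of_simplices n m).
Proof. exact: imset2_f. Qed.

Variable Y : {set 'I_n * 'I_m}.
Local Notation X := (induced_subcomplex (product_of_simplices n m) Y).

Lemma face_induced Q :
  (Q \in face X) = (Q == setX (rows Q) (cols Q)) && (Q \subset Y).
Proof. by rewrite inE face_product. Qed.

Lemma facet_rows P Q : facet X P Q -> rows Q \subset rows P.
Proof. by case/and4P=> _ _ /proper_sub/imsetS. Qed.

Lemma facet_cols P Q : facet X P Q -> cols Q \subset cols P.
Proof. by case/and4P=> _ _ /proper_sub/imsetS. Qed.

Lemma facet_rank P Q : facet X P Q -> frank X P = (frank X Q).+1.
Proof. by case/and4P=> _ _ _ /eqP. Qed.

Lemma facet_of_rank P Q : P \in face X -> Q \subset P -> Q \in face X ->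
  frank X P = (frank X Q).+1 -> facet X P Q.
Proof.
move=> PX sQP QX rkP; rewrite /facet PX QX rkP eqxx properEneq sQP !andbT /=.
by apply: contra_eq_neq rkP => ->; rewrite neq_ltn ltnSn.
Qed.

Lemma frank_induced Q : frank X Q = (#|rows Q| + #|cols Q|).-1.
Proof. by []. Qed.

(** For empty [B] the truncated predecessor gives rank 0, so the empty face fits the formula as the
    face of row [r] with no column. *)
Lemma rank_row r B : frank X (setX [set r] B) = #|B|.
Proof.
rewrite frank_induced; have [->|B0] := eqVneq B set0.
  by rewrite setX0r !imset0 !cards0.
by rewrite rows_setX // cols_setX ?cards1 // -cards_eq0 cards1.
Qed.

End ProductFaces.

(** * Acyclicity when one row dominates all the others *)

(* Adding the row [r] to a face, then the column [c] to a face that lies in the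
   row [r], matches all the faces, including the empty one, in pairs. *)
Lemma dominated_acyclic (K : fieldType) (n m : nat) (Y W : {set 'I_n * 'I_m})
    (d : {set 'I_n * 'I_m} -> {set 'I_n * 'I_m} -> K) (k : nat)
    (r : 'I_n) (c : 'I_m) (z : {set 'I_n * 'I_m} -> K)
    (X := induced_subcomplex (product_of_simplices n m) Y) :
    W \subset Y -> (r, c) \in W -> (forall v, v \in W -> (r, v.2) \in W) ->
    (forall P Q, (d P Q != 0) = facet X P Q) ->
    (forall P R, \sum_Q d P Q * d Q R = 0) ->
    (forall P, z P != 0 -> [/\ P \in face X, P \subset W & frank X P = k]) ->
    (forall Q, \sum_P z P * d P Q = 0) ->
  exists2 w : {set 'I_n * 'I_m} -> K,
    forall P, w P != 0 -> [/\ P \in face X, P \subset W & frank X P = k.+1]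
  & forall P, z P = \sum_Q w Q * d Q P.
Proof.
move=> sWY Wrc rdom d_facet dd0 zP dz.
pose rows (Q : {set 'I_n * 'I_m}) := [set v.1 | v in Q].
pose cols (Q : {set 'I_n * 'I_m}) := [set v.2 | v in Q].
pose D := [set Q in face X | Q \subset W].
have DX Q : Q \in D -> Q = setX (rows Q) (cols Q).
  by rewrite inE face_induced => /andP[/andP[/eqP]].
have XD A B : setX A B \subset W -> setX A B \in D.
  by move=> sW; rewrite !inE setX_in_product sW (subset_trans sW).
have inX Q : Q \in D -> Q \in face X by rewrite inE => /andP[].
have sDW Q : Q \in D -> Q \subset W by rewrite inE => /andP[].
have rk_d P Q : d P Q != 0 -> frank X P = (frank X Q).+1.
  by rewrite d_facet => /facet_rank.
have closedD P Q : P \in D -> d P Q != 0 -> Q \in D.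
  rewrite d_facet => PD /and4P[_ QX /proper_sub sQP _]; rewrite inE QX.
  exact: subset_trans sQP (sDW _ PD).
have colsW Q j : Q \in D -> j \in cols Q -> (r, j) \in W.
  by move=> QD /imsetP[v vQ ->]; apply: rdom; apply: (subsetP (sDW _ QD)).
(* The empty face is left out because it has no column: [up set0] would again be [set0]. It is
   matched in the second round. *)
pose L := [set Q in D | (Q != set0) && (r \notin rows Q)].
pose up Q := setX (r |: rows Q) (cols Q).
have LD Q : Q \in L -> Q \in D by rewrite inE => /andP[].
have L0 Q : Q \in L -> Q != set0 by rewrite inE => /and3P[].
have Lr Q : Q \in L -> r \notin rows Q by rewrite inE => /and3P[].
have rows_up Q : Q \in L -> rows (up Q) = r |: rows Q.
  by move=> /L0 Q0; rewrite /rows rows_setX // cols_eq0.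
have cols_up Q : cols (up Q) = cols Q.
  by rewrite /cols cols_setX //; apply/set0Pn; exists r; rewrite setU11.
have upD Q : Q \in D -> up Q \in D.
  move=> QD; apply: XD; apply/subsetP=> -[i j].
  rewrite mem_setX => /andP[/setU1P[/= ->|iQ] jQ]; first exact: colsW jQ.
  by apply: (subsetP (sDW _ QD)); rewrite (DX _ QD) mem_setX iQ.
have [||||||w wP [y [yP dy zE]]] :=
    @matching_elimination K _ d (frank X) D L up k z rk_d dd0 closedD.
- move=> Q QL; rewrite inE upD ?LD // andbT inE !negb_and negbK.
  by rewrite rows_up // setU11 !orbT.
- move=> Q QL; rewrite d_facet facet_of_rank ?inX ?upD ?LD //.
    by rewrite {1}(DX Q) ?LD // setXS // subsetU1.
  rewrite !frank_induced -!/(rows _) -!/(cols _) rows_up // cols_up.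
  rewrite cardsU1 Lr // addSn prednK // addn_gt0 card_gt0 rows_eq0.
  by rewrite L0.
- move=> P Q PL QL /[dup] /(congr1 rows); rewrite !rows_up // => eqr.
  move/(congr1 cols); rewrite !cols_up => eqc.
  rewrite (DX P) ?LD // (DX Q) ?LD // eqc -(setU1K (Lr _ PL)) eqr.
  by rewrite setU1K ?Lr.
(* Having a facet, [P] is nonempty, so [P] outside [L] contains row [r]. Then [P] contains [up Q],
   and a rank difference of 1 leaves no room for a further row or column. *)
- move=> P Q /setDP[PD PnL] QL; rewrite d_facet => PQ.
  have rP : r \in rows P.
    apply: contraR PnL => rP; rewrite inE PD rP andbT /=.
    apply: contraTneq PQ => ->; apply/negP => /and4P[_ _ /proper_card].
    by rewrite cards0.
  have sr : r |: rows Q \subset rows P.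
    by rewrite subUset sub1set rP (facet_rows PQ).
  have sc : cols Q \subset cols P by exact: facet_cols PQ.
  have := facet_rank PQ; rewrite !frank_induced -!/(rows _) -!/(cols _).
  have r0 : (0 < #|rows Q|)%N by rewrite card_gt0 rows_eq0 L0.
  have := subset_leq_card sr; have := subset_leq_card sc.
  rewrite cardsU1 Lr //= => lec ler rk.
  have eqrc : (#|rows P| + #|cols P| = (1 + #|rows Q|) + #|cols Q|)%N.
    rewrite -[LHS]prednK ?rk ?addSn ?add0n ?prednK ?addn_gt0 ?r0 //.
    by rewrite (leq_trans _ ler).
  have /eqP eqc : cols Q == cols P.
    rewrite eqEcard sc -(leq_add2l #|rows P|) eqrc.
    by rewrite leq_add2r.
  have /eqP eqr : r |: rows Q == rows P.
    by rewrite eqEcard sr cardsU1 Lr // -(leq_add2r #|cols P|) eqrc eqc leqnn.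
  by rewrite (DX _ PD) -eqr -eqc.
- by move=> P /zP[PX PW rkP]; rewrite inE PX PW.
- exact: dz.
(* The faces left by the first round lie in row [r]; the empty face is among them. *)
pose D2 := [set Q in D | rows Q \subset [set r]].
have D2D Q : Q \in D2 -> Q \in D by rewrite inE => /andP[].
have D2X Q : Q \in D2 -> Q = setX [set r] (cols Q).
  rewrite inE => /andP[QD]; rewrite subset1 => /orP[/eqP <-|]; first exact: DX.
  by rewrite rows_eq0 => /eqP->; rewrite /cols imset0 setX0r.
have XD2 (B : {set 'I_m}) :
    (forall j, j \in B -> (r, j) \in W) -> setX [set r] B \in D2.
  move=> BW; rewrite inE XD; last first.
    by apply/subsetP=> -[i j]; rewrite mem_setX => /andP[/set1P /= -> /BW].
  by apply/subsetP=> i /imsetP[v]; rewrite mem_setX => /andP[vr _ ->].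
have colsX (B : {set 'I_m}) : cols (setX [set r] B) = B.
  by rewrite /cols cols_setX //; apply/set0Pn; exists r; rewrite set11.
(* This time the empty face belongs to the lower half: it is matched with the vertex [(r, c)]. *)
pose L2 := [set Q in D2 | c \notin cols Q].
pose up2 Q := setX [set r] (c |: cols Q).
have L2D2 Q : Q \in L2 -> Q \in D2 by rewrite inE => /andP[].
have L2c Q : Q \in L2 -> c \notin cols Q by rewrite inE => /andP[].
have rkD2 Q : Q \in D2 -> frank X Q = #|cols Q|.
  by move/D2X=> defQ; rewrite {1}defQ rank_row.
have up2D Q : Q \in D2 -> up2 Q \in D2.
  move=> QD; apply: XD2 => j; rewrite !inE => /orP[/eqP-> //|].
  exact/colsW/D2D.
have [|||||||w2 w2P [x [xP _ yE]]] :=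
    @matching_elimination K _ d (frank X) D2 L2 up2 k y rk_d dd0.
- move=> P Q /setIdP[PD sP] dPQ; apply/setIdP; split; first exact: closedD dPQ.
  by move: dPQ; rewrite d_facet => /facet_rows/subset_trans; apply.
- by move=> Q QL; rewrite inE up2D ?L2D2 // inE colsX setU11 !andbF.
- move=> Q QL; rewrite d_facet facet_of_rank ?inX ?D2D ?up2D ?L2D2 //.
    by rewrite {1}(D2X Q) ?L2D2 // setXS // subsetU1.
  by rewrite !rkD2 ?up2D ?L2D2 // colsX cardsU1 L2c.
- move=> P Q PL QL /(congr1 cols); rewrite !colsX => eqc.
  rewrite (D2X P) ?L2D2 // (D2X Q) ?L2D2 // -(setU1K (L2c _ PL)) eqc.
  by rewrite setU1K ?L2c.
- move=> P Q /setDP[PD PnL] QL; rewrite d_facet => PQ.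
  have cP : c \in cols P by apply: contraR PnL => cP; apply/setIdP.
  have := facet_rank PQ; rewrite (rkD2 _ PD) (rkD2 _ (L2D2 _ QL)) => rk.
  have /eqP eqc : c |: cols Q == cols P.
    rewrite eqEcard subUset sub1set cP (facet_cols PQ) /=.
    by rewrite cardsU1 L2c // rk.
  by rewrite (D2X _ PD) -eqc.
- move=> P /yP[/setDP[/setDP[PD PnL] PnU] rkP]; split=> //; rewrite inE PD /=.
  apply: contraR PnU => PnD2.
  have [P0|P0] := eqVneq P set0.
    by rewrite P0 /rows imset0 sub0set in PnD2.
  have rP : r \in rows P by move: PnL; rewrite inE PD P0 /= negbK.
  (* [P] has row [r] and at least one other row, so deleting row [r] gives a nonempty face, whose
     partner is [P]. *)
  pose Q := setX (rows P :\ r) (cols P).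
  have sQP : Q \subset P by rewrite (DX _ PD) setXS // subD1set.
  have A0 : rows P :\ r != set0.
    by rewrite setD_eq0.
  have rQ : rows Q = rows P :\ r by rewrite /rows rows_setX // cols_eq0.
  apply/imsetP; exists Q.
    rewrite inE rQ setD11 XD ?(subset_trans sQP) ?sDW //= -rows_eq0.
    by rewrite -/(rows Q) rQ A0.
  by rewrite /up rQ setD1K // /cols cols_setX // -/(cols P) -DX.
- exact: dy.
(* The second round leaves no face unmatched: a face of [D2] outside [L2] contains column [c], hence
   is the partner of the face without it. *)
have x0 P : x P = 0.
  apply/eqP; apply/contraT => /xP[/setDP[/setDP[PD PnL] nU] _].
  have cP : c \in cols P by apply: contraR PnL => cP; apply/setIdP.
  case/imsetP: nU; exists (setX [set r] (cols P :\ c)).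
    rewrite inE colsX setD11 XD2 // => j /setD1P[_].
    exact/colsW/D2D.
  by rewrite /up2 colsX setD1K // -D2X.
exists (fun P => w P + w2 P) => [P wP0|P].
  have [w0|/wP[PD rkP]] := eqVneq (w P) 0; last by rewrite inX ?sDW.
  move: wP0; rewrite w0 add0r => /w2P[/D2D PD rkP]; by rewrite inX ?sDW.
rewrite zE yE x0 add0r addrC -big_split /=.
by apply: eq_bigr => Q _; rewrite mulrDl.
Qed.

(** * Exactness over the polynomial ring from exactness in each multidegree *)

Lemma mcoeff_MXle (R : nzRingType) (N : nat) (p : {mpoly R[N]}) (a u : 'X_{1..N}) :
  (p * 'X_[a])@_u = if (a <= u)%MM then p@_(u - a) else 0.
Proof.
case: ifPn => [le_au|nle_au]; first by rewrite -{1}(submK le_au) addmC mcoeffMX.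
apply: memN_msupp_eq0; apply: contra nle_au.
by rewrite (perm_mem (msuppMX _ _)) => /mapP[v _ ->]; apply: lem_addr.
Qed.

Section CellularResolution.
Variables (V : finType) (X : cell_complex V) (K : fieldType) (N : nat).
Variables (label : V -> 'X_{1..N}) (eps : {set V} -> {set V} -> int).
Hypothesis epsP : incidence_function X eps.
Implicit Types (P Q R : {set V}) (b : 'X_{1..N}).
Local Notation S := {mpoly K[N]}.
Local Notation lab := (face_label label).
Local Notation bd := (boundary_coef X K label eps).
Local Notation F := (cellular_complex X K label eps).

(** The boundary with all monomials set to 1. It is the differential in every multidegree; only the
    set of available faces depends on the degree. *)
Definition scalar_boundary P Q : K := if facet X P Q then (eps P Q)%:~R else 0.

Lemma scalar_boundary_neq0 P Q : (scalar_boundary P Q != 0) = facet X P Q.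
Proof.
rewrite /scalar_boundary; case: ifPn => [/epsP.1[]->|_]; last by rewrite eqxx.
  exact: oner_neq0.
by rewrite rmorphN1 oppr_eq0 oner_neq0.
Qed.

Lemma scalar_boundary2 P R :
  \sum_Q scalar_boundary P Q * scalar_boundary Q R = 0.
Proof.
have /(congr1 (fun z : int => z%:~R : K)) := epsP.2 P R; rewrite rmorph_sum /=.
rewrite rmorph0 big_mkcond /= => eps0; rewrite -[RHS]eps0.
apply: eq_bigr => Q _; rewrite /scalar_boundary.
by case: (facet X P Q); case: (facet X Q R); rewrite ?mul0r ?mulr0 ?rmorphM.
Qed.

Lemma face_label_le Q b : (lab Q <= b)%MM = [forall v in Q, (label v <= b)%MM].
Proof.
transitivity (all (fun v => (v \in Q) ==> (label v <= b)%MM) (index_enum V)).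
  rewrite /face_label; elim: (index_enum V) => [|v s IHs] /=.
    by rewrite big_nil; apply/mnm_lepP=> i; rewrite mnm0E.
  by rewrite big_cons -IHs; case: (v \in Q); rewrite //= lem_mlcm.
apply/allP/forall_inP => [le_b v|le_b v _]; last exact/implyP/le_b.
by apply/implyP/le_b/mem_index_enum.
Qed.

Lemma label_le_face Q v : v \in Q -> (label v <= lab Q)%MM.
Proof. by move: v; apply/forall_inP; rewrite -face_label_le lepm_refl. Qed.

Lemma face_labelS P Q : Q \subset P -> (lab Q <= lab P)%MM.
Proof.
move/subsetP=> sQP; rewrite face_label_le; apply/forall_inP=> v /sQP.
exact: label_le_face.
Qed.

Lemma face_label0 : lab set0 = 0%MM.
Proof. by rewrite /face_label big_pred0 // => v; rewrite inE. Qed.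

Lemma face_label1 v : lab [set v] = label v.
Proof.
have le_v : (lab [set v] <= label v)%MM.
  by rewrite face_label_le; apply/forall_inP=> w /set1P->; apply: lepm_refl.
apply/mnmP=> i; apply/eqP; rewrite eqn_leq (mnm_lepP le_v).
exact/mnm_lepP/label_le_face/set11.
Qed.

Lemma facet_label P Q : facet X P Q -> (lab Q <= lab P)%MM.
Proof. by case/and4P=> _ _ /proper_sub/face_labelS. Qed.

Lemma boundary_coefE P Q : bd P Q = scalar_boundary P Q *: 'X_[lab P - lab Q].
Proof.
by rewrite /boundary_coef /scalar_boundary; case: ifP; rewrite ?scale0r.
Qed.

(** Along a chain of facets from [P] through [Q] to [R] the monomials telescope to the exponent
    [lab P - lab R], independent of [Q], leaving the scalar identity. *)
Lemma boundary_coef2 P R : \sum_Q bd P Q * bd Q R = 0.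
Proof.
under eq_bigr => Q _ do rewrite !boundary_coefE.
transitivity (\sum_Q (scalar_boundary P Q * scalar_boundary Q R) *:
  ('X_[lab P - lab R] : S)); last by rewrite -scaler_suml scalar_boundary2 scale0r.
apply: eq_bigr => Q _; rewrite -scalerAl -scalerAr scalerA.
have [PQ|] := boolP (facet X P Q); last first.
  by rewrite -scalar_boundary_neq0 negbK => /eqP->; rewrite mul0r !scale0r.
have [QR|] := boolP (facet X Q R); last first.
  by rewrite -scalar_boundary_neq0 negbK => /eqP->; rewrite mulr0 !scale0r.
rewrite -mpolyXD; congr (_ *: 'X_[_]).
move/facet_label/mnm_lepP: PQ => PQ; move/facet_label/mnm_lepP: QR => QR.
by apply/mnmP=> i; rewrite !mnmE addnBA // subnK.
Qed.

(** Chains are functions on all sets of vertices, constrained by their support. Since [Q] may be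
    [set0], the case [k = 0] is exactness at the vertices with respect to the augmentation. *)
Definition strand_acyclic b := forall (k : nat) (z : {set V} -> K),
  (forall P, z P != 0 -> [/\ P \in face X, (lab P <= b)%MM & frank X P = k.+1]) ->
  (forall Q, \sum_P z P * scalar_boundary P Q = 0) ->
  exists2 w : {set V} -> K,
    forall P, w P != 0 -> [/\ P \in face X, (lab P <= b)%MM & frank X P = k.+2]
  & forall P, z P = \sum_Q w Q * scalar_boundary Q P.

Hypothesis strands : forall b, strand_acyclic b.

Definition strand b (f : {set V} -> S) P : K :=
  if (lab P <= b)%MM then (f P)@_(b - lab P) else 0.

(** This is the coefficient of exponent [b - lab Q] in the cycle equation. If [lab Q] does not
    divide [b], neither does the label of any face having [Q] as a facet, and every term is zero. *)
Lemma strand_cycle b f Q :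
    \sum_P f P * bd P Q = 0 ->
  \sum_P strand b f P * scalar_boundary P Q = 0.
Proof.
move=> f0; have [le_Qb|nle_Qb] := boolP (lab Q <= b)%MM; last first.
  apply: big1 => P _; rewrite /strand; case: ifP => [le_Pb|]; last by rewrite mul0r.
  rewrite /scalar_boundary; case: ifP => [PQ|]; last by rewrite mulr0.
  by rewrite (lepm_trans (facet_label PQ)) in nle_Qb.
have := congr1 (mcoeff (b - lab Q)%MM) f0; rewrite mcoeff0 raddf_sum /= => f0b.
rewrite -[RHS]f0b; apply: eq_bigr => P _.
rewrite boundary_coefE -scalerAr mcoeffZ mulrC.
have [PQ|] := boolP (facet X P Q); last first.
  by rewrite -scalar_boundary_neq0 negbK => /eqP->; rewrite !mul0r.
congr (_ * _); rewrite mcoeff_MXle /strand.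
move/facet_label/mnm_lepP: (PQ) => lePQ; move/mnm_lepP: (le_Qb) => leQb.
have -> : (lab P - lab Q <= b - lab Q)%MM = (lab P <= b)%MM.
  apply/mnm_lepP/mnm_lepP=> le_b i; have := le_b i; rewrite !mnmE.
    by rewrite leq_sub2rE.
  by move=> ?; apply: leq_sub2r.
case: ifP => // /mnm_lepP lePb; congr (_@__); apply/mnmP=> i; rewrite !mnmE.
by rewrite subnBA // subnK.
Qed.

Lemma sum_strands f : exists bs : seq 'X_{1..N}, forall P,
  f P = \sum_(b <- bs) strand b f P *: 'X_[b - lab P].
Proof.
(* All degrees in which some [f P] has a monomial, each listed once so that no component is counted
   twice. *)
exists (undup (flatten
  [seq [seq (lab P + u)%MM | u <- msupp (f P)] | P <- enum {set V}])).
set bs := undup _ => P; apply/mpolyP=> u; rewrite raddf_sum /=.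
have term b : (strand b f P *: 'X_[b - lab P] : S)@_u =
    if b == (lab P + u)%MM then (f P)@_u else 0.
  rewrite mcoeffZ mcoeffX /strand.
  have [->|ne_b] := eqVneq b (lab P + u)%MM.
    by rewrite lem_addr addmC addmK eqxx mulr1.
  case: ifP => [le_b|]; last by rewrite mul0r.
  have [def_u|] := eqVneq (b - lab P)%MM u; last by rewrite mulr0.
  by case/eqP: ne_b; rewrite -def_u addmC submK.
under eq_bigr => b _ do rewrite term.
have [in_bs|nin_bs] := boolP ((lab P + u)%MM \in bs).
  by rewrite -big_mkcond -big_filter filter_pred1_uniq ?undup_uniq ?big_seq1.
rewrite big_seq big1 => [|b b_in]; last first.
  by case: eqP => // def_b; rewrite -def_b b_in in nin_bs.
apply: memN_msupp_eq0; apply: contra nin_bs => u_in.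
rewrite mem_undup; apply/flatten_mapP; exists P; first by rewrite mem_enum.
by apply/mapP; exists u.
Qed.

(** Each of the finitely many strands of [f] is filled over [K]; the filling [w] in degree [b]
    becomes homogeneous over [S] when its value at [P] is multiplied by the monomial of exponent
    [b - lab P]. *)
Lemma polynomial_exactness k (f : {set V} -> S) :
    (forall P, f P != 0 -> P \in faces_of_rank X k.+1) ->
    (forall Q, \sum_P f P * bd P Q = 0) ->
  exists2 g : {set V} -> S,
    forall P, g P != 0 -> P \in faces_of_rank X k.+2
  & forall P, f P = \sum_Q g Q * bd Q P.
Proof.
move=> fP f0; have [bs fE] := sum_strands f.
suff [g gP gE] : exists2 g : {set V} -> S,
    forall P, g P != 0 -> P \in faces_of_rank X k.+2
  & forall P, \sum_(b <- bs) strand b f P *: 'X_[b - lab P] = \sum_Q g Q * bd Q P.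
  by exists g => // P; rewrite -gE -fE.
elim: bs {fE} => [|b bs [g gP gE]].
  exists (fun=> 0) => [P|P]; first by rewrite eqxx.
  by rewrite big_nil big1 // => Q _; rewrite mul0r.
have [P|Q|w wP wE] := @strands b k (strand b f).
- rewrite /strand; case: ifP => [_ fPb|]; last by rewrite eqxx.
  have /fP : f P != 0 by apply: contraNneq fPb => ->; rewrite mcoeff0.
  by rewrite inE => /andP[-> /eqP].
- exact/strand_cycle.
exists (fun P => w P *: 'X_[b - lab P] + g P) => [P|P].
  have [->|/wP[PX _ rkP] _] := eqVneq (w P) 0; first by rewrite scale0r add0r => /gP.
  by rewrite inE PX rkP eqxx.
rewrite big_cons gE wE; under [RHS]eq_bigr => Q _ do rewrite mulrDl.
rewrite big_split /=; congr (_ + _); rewrite scaler_suml; apply: eq_bigr => Q _.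
rewrite boundary_coefE -scalerAl -scalerAr scalerA.
have [QP|] := boolP (facet X Q P); last first.
  by rewrite -scalar_boundary_neq0 negbK => /eqP->; rewrite mulr0 !scale0r.
have [->|/wP[_ /mnm_lepP leQb _]] := eqVneq (w Q) 0.
  by rewrite mul0r !scale0r.
rewrite -mpolyXD; congr (_ *: 'X_[_]).
move/facet_label/mnm_lepP: QP => lePQ.
by apply/mnmP=> i; rewrite !mnmE addnBA // subnK.
Qed.

(** Turns a row vector indexed by the enumeration of the faces of rank [k] into a function on all
    sets of vertices, zero elsewhere. *)
Definition row_ext k (v : 'rV[S]_#|faces_of_rank X k|) P : S :=
  \sum_(p | enum_val p == P) v 0 p.

Lemma row_extP k (v : 'rV[S]_#|faces_of_rank X k|) P :
  row_ext v P != 0 -> P \in faces_of_rank X k.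
Proof.
apply: contraNT => nP; apply/eqP/big1 => p /eqP defP.
by case/negP: nP; rewrite -defP; apply: enum_valP.
Qed.

Lemma row_ext_enum_val k (v : 'rV[S]_#|faces_of_rank X k|) p :
  row_ext v (enum_val p) = v 0 p.
Proof.
rewrite /row_ext (bigD1 p) //= big1 ?addr0 // => q /andP[/eqP/enum_val_inj->].
by rewrite eqxx.
Qed.

Lemma sum_row_ext k (v : 'rV[S]_#|faces_of_rank X k|) (h : {set V} -> S) :
  \sum_P row_ext v P * h P = \sum_p v 0 p * h (enum_val p).
Proof.
rewrite [RHS](partition_big (fun p => enum_val p) xpredT) //=.
apply: eq_bigr => P _; rewrite mulr_suml; apply: eq_bigr => p /eqP-> //.
Qed.

Lemma sum_enum_val k (g h : {set V} -> S) :
    (forall P, g P != 0 -> P \in faces_of_rank X k) ->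
  \sum_(p < #|faces_of_rank X k|) g (enum_val p) * h (enum_val p) = \sum_P g P * h P.
Proof.
move=> gP; rewrite -(big_enum_val (fun P => g P * h P)) /=.
rewrite big_mkcond; apply: eq_bigr => P _; case: ifPn => // nP.
by have [->|/gP] := eqVneq (g P) 0; rewrite ?mul0r // (negPf nP).
Qed.

Lemma mulmx_boundary k (v : 'rV[S]_#|faces_of_rank X k.+2|) q :
  (v *m gc_diff F k) 0 q = \sum_P row_ext v P * bd P (enum_val q).
Proof.
rewrite (sum_row_ext v (fun P => bd P (enum_val q))) mxE.
by apply: eq_bigr => p _; rewrite mxE.
Qed.

Lemma mulmx_aug (v : 'rV[S]_#|faces_of_rank X 1|) q :
  (v *m gc_aug F) 0 q = \sum_P row_ext v P * bd P set0.
Proof.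
rewrite (sum_row_ext v (fun P => bd P set0)) mxE.
by apply: eq_bigr => p _; rewrite mxE.
Qed.

Lemma boundary_coef_rank P Q k :
  P \in faces_of_rank X k.+1 -> Q \notin faces_of_rank X k -> bd P Q = 0.
Proof.
rewrite !inE => /andP[PX /eqP rkP]; apply: contraNeq; rewrite /boundary_coef.
case: ifP => [/and4P[_ -> _]|]; last by rewrite eqxx.
by rewrite rkP eqSS eq_sym.
Qed.

(** Serves both exactness statements at once: a cycle condition over all [Q] covers the
    differentials and, at [Q = set0], the augmentation. *)
Lemma boundary_of_row k (v : 'rV[S]_#|faces_of_rank X k.+1|) :
    (forall Q, \sum_P row_ext v P * bd P Q = 0) <->
  exists w : 'rV_(gc_rank F k.+1), v = w *m gc_diff F k.
Proof.
split=> [v0|[w def_v] Q].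
  have [g gP gE] := polynomial_exactness (@row_extP _ v) v0.
  exists (\row_p g (enum_val p)); apply/rowP=> q; rewrite -row_ext_enum_val gE.
  by rewrite mxE -(sum_enum_val _ gP); apply: eq_bigr => p _; rewrite !mxE.
have row_extE P : row_ext v P = \sum_R row_ext w R * bd R P.
  have [Pk|nPk] := boolP (P \in faces_of_rank X k.+1).
    by rewrite -(enum_rankK_in Pk Pk) row_ext_enum_val def_v mulmx_boundary.
  rewrite [RHS]big1; first by apply/eqP; apply: contraNT nPk; apply: row_extP.
  move=> R _; have [->|/row_extP Rk] := eqVneq (row_ext w R) 0; first exact: mul0r.
  by rewrite (boundary_coef_rank Rk nPk) mulr0.
under eq_bigr => P _ do rewrite row_extE mulr_suml.
rewrite exchange_big big1 // => R _.
under eq_bigr => P _ do rewrite -mulrA.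
by rewrite -mulr_sumr boundary_coef2 mulr0.
Qed.

Lemma cellular_complex_acyclic :
  (forall Q, Q \in faces_of_rank X 0 -> Q = set0) -> is_acyclic F.
Proof.
move=> rank0; split=> [k v|v]; rewrite -boundary_of_row; split=> [v0 Q|v0].
- have [Qk|nQk] := boolP (Q \in faces_of_rank X k.+1).
    by rewrite -(enum_rankK_in Qk Qk) -mulmx_boundary v0 mxE.
  apply: big1 => P _; have [->|/row_extP Pk] := eqVneq (row_ext v P) 0.
    exact: mul0r.
  by rewrite (boundary_coef_rank Pk nQk) mulr0.
- by apply/rowP=> q; rewrite mulmx_boundary v0 mxE.
- have [/rank0->|nQk] := boolP (Q \in faces_of_rank X 0).
    by rewrite -(mulmx_aug v 0) v0 mxE.
  apply: big1 => P _; have [->|/row_extP Pk] := eqVneq (row_ext v P) 0.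
    exact: mul0r.
  by rewrite (boundary_coef_rank Pk nQk) mulr0.
by apply/rowP=> q; rewrite mulmx_aug v0 mxE.
Qed.

End CellularResolution.

(** * Grading, minimality and the resolved ideal *)

Lemma monomial_graded_map (K : fieldType) (N r s : nat)
    (a : 'I_r -> 'X_{1..N}) (a' : 'I_s -> 'X_{1..N}) (c : 'I_r -> 'I_s -> K)
    (M : 'M[{mpoly K[N]}]_(r, s)) :
    (forall p q, M p q = c p q *: 'X_[a p - a' q]) ->
    (forall p q, c p q != 0 -> (a' q <= a p)%MM) ->
  graded_map a a' M.
Proof.
move=> defM le_a b v hom_v q u; apply: contraTeq => ne_b.
rewrite mcoeff_msupp negbK mxE raddf_sum big1 //= => p _; apply/eqP.
rewrite defM -scalerAr mcoeffZ mcoeff_MXle.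
apply: contraNT ne_b; rewrite mulf_eq0 negb_or => /andP[/le_a/mnm_lepP le_a'].
case: ifP => [/mnm_lepP le_u|]; last by rewrite eqxx.
rewrite -mcoeff_msupp => /hom_v <-; apply/eqP/mnmP=> i.
have:= le_u i; rewrite !mnmE => le_ui.
by rewrite addnBA // [(a p i + _)%N]addnC -addnBA ?leq_subr // subKn // addnC.
Qed.

Section CellularIdeal.
Variables (V : finType) (X : cell_complex V) (K : fieldType) (N : nat).
Variables (label : V -> 'X_{1..N}) (eps : {set V} -> {set V} -> int).
Hypothesis epsP : incidence_function X eps.
Local Notation S := {mpoly K[N]}.
Local Notation lab := (face_label label).
Local Notation F := (cellular_complex X K label eps).

Lemma cellular_complex_graded : is_graded F.
Proof.
split=> [k|].
  apply: (monomial_graded_map (c := fun p q =>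
    scalar_boundary X K eps (enum_val p) (enum_val q))) => p q.
    by rewrite mxE boundary_coefE.
  by rewrite scalar_boundary_neq0 //; apply: facet_label.
apply: (monomial_graded_map (c := fun p _ =>
    scalar_boundary X K eps (enum_val p) set0)) => p q.
  by rewrite mxE boundary_coefE face_label0.
by move=> _; apply/mnm_lepP=> i; rewrite mnm0E.
Qed.

(** A nonzero entry is a sign times the monomial of exponent [lab P - lab Q], so it has a constant
    term only when the labels agree. Faces [Q] of rank 0 occur only in the augmentation. *)
Lemma cellular_complex_minimal :
    (forall P Q, facet X P Q -> (0 < frank X Q)%N -> lab P <> lab Q) ->
  is_minimal F.
Proof.
move=> lab_neq k v q; rewrite mxE raddf_sum big1 //= => p _.
rewrite mxE boundary_coefE -scalerAr mcoeffZ mcoeff_MXle.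
have [PQ|] := boolP (facet X (enum_val p) (enum_val q)); last first.
  by rewrite -(scalar_boundary_neq0 K epsP) negbK => /eqP->; rewrite mul0r.
case: ifP => [/mnm_lepP le0|]; last by rewrite mulr0.
case: (lab_neq _ _ PQ).
  by have := enum_valP q; rewrite inE => /andP[_ /eqP->].
apply/mnmP=> i; apply/eqP; rewrite eqn_leq (mnm_lepP (facet_label _ PQ)) andbT.
by have := le0 i; rewrite !mnmE leqn0 subn_eq0.
Qed.

Variable Y : {set V}.
Hypothesis face0 : set0 \in face X.
Hypothesis rank0 : frank X set0 = 0%N.
Hypothesis rank1 : faces_of_rank X 1 = [set [set v] | v in Y].

Lemma sum_vertices (h : {set V} -> S) :
  \sum_(p < #|faces_of_rank X 1|) h (enum_val p) = \sum_(v in Y) h [set v].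
Proof.
rewrite -(big_enum_val h) rank1 big_imset //=.
by move=> v w _ _ /set1_inj.
Qed.

(** The augmentation sends a vertex to its label up to a sign; that sign, being its own inverse, can
    be absorbed into the coefficients. *)
Lemma scalar_vertex_boundary_sqr v : v \in Y ->
  scalar_boundary X K eps [set v] set0 * scalar_boundary X K eps [set v] set0 = 1.
Proof.
move=> vY; have : [set v] \in faces_of_rank X 1 by rewrite rank1 imset_f.
rewrite inE => /andP[vX /eqP rkv].
have v0 : facet X [set v] set0.
  rewrite /facet vX face0 rkv rank0 eqxx proper0 andbT.
  by apply/set0Pn; exists v; rewrite set11.
rewrite /scalar_boundary v0; case: (epsP.1 _ _ v0) => ->; first by rewrite mulr1.
by rewrite rmorphN1 mulrNN mulr1.
Qed.

Lemma cellular_complex_image f :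
  aug_image F f <-> ideal_gen (mem Y) (fun v => 'X_[label v]) f.
Proof.
split=> [[v ->]|[c ->]].
  rewrite mulmx_aug.
  exists (fun v' => row_ext v [set v'] *
     (scalar_boundary X K eps [set v'] set0)%:MP).
  rewrite -(sum_enum_val _ (@row_extP _ X K N 1 v)).
  rewrite (sum_vertices (fun P => row_ext v P * boundary_coef X K label eps P set0)).
  apply: eq_bigr => w wY; rewrite boundary_coefE face_label0 subm0 face_label1.
  by rewrite -mulrA mul_mpolyC.
(* [pick] recovers [v] from [[set v]], and the second factor cancels the sign of the
   augmentation. *)
pose g (P : {set V}) := (if [pick v in P] is Some v then c v else 0)
  * (scalar_boundary X K eps P set0)%:MP.
exists (\row_p g (enum_val p)); rewrite mxE.
under [RHS]eq_bigr => p _ do rewrite !mxE.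
rewrite (sum_vertices (fun P => g P * boundary_coef X K label eps P set0)).
apply: eq_bigr => v vY; rewrite /g; case: pickP => [w /set1P->|/(_ v)]; last first.
  by rewrite set11.
rewrite boundary_coefE face_label0 subm0 face_label1 -mulrA mul_mpolyC scalerA.
by rewrite scalar_vertex_boundary_sqr // scale1r.
Qed.

End CellularIdeal.

(** The specialization is a surjective ring morphism, so the image of an ideal is generated by the
    images of its generators. Sending each [x_j] to [y_j] gives the section [lift] that supplies
    preimages of coefficients. *)
Lemma specialized_idealE (K : fieldType) (n m : nat) (lam mu : 'I_n -> nat)
    (le_nm : (n <= m)%N) (f : {mpoly K[m]}) :
  ideal_gen (mem (skew_shape m lam mu)) (fun v => 'X_[specialized_label le_nm v]) f
    <-> specialized_ideal lam mu le_nm f.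
Proof.
split=> [[c ->]|[_ [c ->] ->]].
  pose lift (p : {mpoly K[m]}) : {mpoly K[n + m]} :=
    p \mPo [tuple 'X_(rshift n j) | j < m].
  have liftK p : specialization le_nm (lift p) = p.
    rewrite /lift -[RHS]comp_mpoly_id !comp_mpolyE /specialization raddf_sum /=.
    apply: eq_bigr => a _; rewrite comp_mpolyZ rmorph_prod; congr (_ *: _).
    apply: eq_bigr => j _; rewrite rmorphXn !tnth_mktuple /= comp_mpolyXU.
    by rewrite -tnth_nth tnth_mktuple (unsplitK (inr _ j)).
  exists (\sum_(v in skew_shape m lam mu) lift (c v) * 'X_[xy_label v]).
    by exists (fun v => lift (c v)).
  rewrite /specialization raddf_sum /=; apply: eq_bigr => v _.
  by rewrite rmorphM /= -!/(specialization _ _) liftK specialization_xy_label.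
exists (fun v => specialization le_nm (c v)).
rewrite /specialization raddf_sum /=; apply: eq_bigr => v _.
by rewrite rmorphM /= -!/(specialization _ _) specialization_xy_label.
Qed.

(** * Cells and labels of the specialized Ferrers complex *)

Section FerrersComplex.
Variables (n m : nat) (lam mu : 'I_n -> nat) (le_nm : (n <= m)%N).
Local Notation Y := (skew_shape m lam mu).
Local Notation X := (ferrers_complex m lam mu).
Local Notation label := (specialized_label le_nm).
Local Notation rows Q := [set v.1 | v in Q].
Local Notation cols Q := [set v.2 | v in Q].

Lemma ferrers_face0 : set0 \in face X.
Proof. by rewrite face_induced !imset0 setX0r eqxx sub0set. Qed.

Lemma ferrers_rank_gt0 Q : (0 < frank X Q)%N = (Q != set0).
Proof.
rewrite frank_induced; have [->|Q0] := eqVneq Q set0; first by rewrite !imset0 !cards0.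
have: (0 < #|rows Q|)%N by rewrite card_gt0 rows_eq0.
have: (0 < #|cols Q|)%N by rewrite card_gt0 cols_eq0.
by case: #|rows Q| #|cols Q| => [|a] [|b] //; rewrite addnS.
Qed.

Lemma ferrers_rank1 : faces_of_rank X 1 = [set [set v] | v in Y].
Proof.
apply/setP=> Q; rewrite inE; apply/andP/imsetP=> [[]|[[i j] vY ->]].
  rewrite face_induced => /andP[/eqP defQ sQY] rk1.
  have Q0 : Q != set0 by rewrite -ferrers_rank_gt0 (eqP rk1).
  have /cards1P[i rQ] : #|rows Q| == 1%N.
    move: rk1; rewrite frank_induced.
    have: (0 < #|rows Q|)%N by rewrite card_gt0 rows_eq0.
    have: (0 < #|cols Q|)%N by rewrite card_gt0 cols_eq0.
    by case: #|rows Q| #|cols Q| => [|[|a]] [|b]; rewrite ?addSn ?addnS.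
  have /cards1P[j cQ] : #|cols Q| == 1%N.
    by move: rk1; rewrite frank_induced rQ cards1 add1n.
  have defQ1 : Q = [set (i, j)].
    by rewrite defQ rQ cQ; apply/setP=> -[i' j']; rewrite in_setX !inE.
  by exists (i, j) => //; apply: (subsetP sQY); rewrite defQ1 set11.
rewrite frank_induced !imset_set1 !cards1; split=> //.
rewrite face_induced !imset_set1 sub1set vY andbT.
by apply/eqP/setP=> -[i' j']; rewrite in_setX !inE.
Qed.

Lemma specialized_labelE v k :
  label v k = ((widen_ord le_nm v.1 == k) + (v.2 == k))%N.
Proof. by rewrite mnmDE !mnm1E. Qed.

(* The exponent at [i] of a row [i] of [P] missing from [Q] is at most 1 in [Q],
   and it can only be 1 there if [i] is also a column of [Q]; in that case the
   diagonal vertex [(i, i)] of [P] has exponent 2. Columns are symmetric. *)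
Lemma ferrers_label_neq P Q : facet X P Q -> (0 < frank X Q)%N ->
  face_label label P <> face_label label Q.
Proof.
move=> PQ; rewrite ferrers_rank_gt0 => Q0 eq_lab.
have [PX QX prQP _] := and4P PQ; have [sQP [[i j] vP vnQ]] := properP prQP.
move: PX QX; rewrite !face_induced => /andP[/eqP defP _] /andP[/eqP defQ _].
have le1 v : v \in P -> (label v <= face_label label Q)%MM.
  by move=> vP'; rewrite -eq_lab; apply: label_le_face.
(* With equal labels, a bound on the exponents at [k] over the vertices of [Q] extends to those of
   [P]. The witness [c] is the label of [Q] with its exponent at [k] replaced by the bound. *)
have leQ a b k : (forall v, v \in Q -> (label v k <= b)%N) -> a \in P ->
    (label a k <= b)%N.
  move=> le_b aP; have /mnm_lepP/(_ k)/leq_trans := le1 _ aP; apply.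
  pose c : 'X_{1..m} :=
    [multinom if k' == k then b else face_label label Q k' | k' < m].
  suff /mnm_lepP/(_ k) : (face_label label Q <= c)%MM by rewrite mnmE eqxx.
  rewrite face_label_le; apply/forall_inP=> v vQ; apply/mnm_lepP=> k'.
  rewrite [c _]mnmE; have [->|_] := eqVneq k' k; first exact: le_b.
  exact/mnm_lepP/label_le_face.
have mem a b : a \in rows P -> b \in cols P -> (a, b) \in P.
  by move=> aP bP; rewrite defP in_setX aP.
have [iP jP] : i \in rows P /\ j \in cols P.
  by split; apply/imsetP; exists (i, j).
have: (i \notin rows Q) || (j \notin cols Q).
  by rewrite -negb_and -in_setX -defQ.
case/orP=> [inQ|jnQ].
  have [v /andP[vQ /eqP vi]|noi] :=
      pickP (fun v => (v \in Q) && (v.2 == widen_ord le_nm i)).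
    have := leQ (i, v.2) 1%N v.2.
    rewrite specialized_labelE /= vi !eqxx => le2; suff: (1 + 1 <= 1)%N by [].
    apply: le2 => [w wQ|]; last by rewrite -vi mem // imset_f // (subsetP sQP).
    rewrite specialized_labelE; case: eqP => [/(congr1 val)/= /val_inj wi|_].
      by case/imsetP: inQ; exists w.
    exact: leq_b1.
  have := leQ (i, j) 0%N (widen_ord le_nm i).
  rewrite specialized_labelE /= eqxx => le1'; suff: (1 <= 0)%N by [].
  apply: leq_trans (leq_addr _ _) (le1' _ vP) => w wQ.
  rewrite specialized_labelE; have := noi w; rewrite wQ /= => ->.
  case: eqP => // /(congr1 val)/= /val_inj wi.
  by case/imsetP: inQ; exists w.
have [v /andP[vQ /eqP vj]|noj] :=
    pickP (fun v => (v \in Q) && (widen_ord le_nm v.1 == j)).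
  have := leQ (v.1, j) 1%N j.
  rewrite specialized_labelE /= vj !eqxx => le2; suff: (1 + 1 <= 1)%N by [].
  apply: le2 => [w wQ|]; last by rewrite mem // imset_f // (subsetP sQP).
  rewrite specialized_labelE addnC; case: eqP => [wj|_]; last exact: leq_b1.
  by case/imsetP: jnQ; exists w.
have := leQ (i, j) 0%N j.
rewrite specialized_labelE /= eqxx => le1'; suff: (1 <= 0)%N by [].
apply: leq_trans (leq_addl _ _) (le1' _ vP) => w wQ.
rewrite specialized_labelE; have := noj w; rewrite wQ /= => ->.
case: eqP => // wj.
by case/imsetP: jnQ; exists w.
Qed.

(** * Exactness of the strands of the Ferrers complex *)

Hypothesis lam_noninc : forall i j : 'I_n, (i <= j)%N -> (lam j <= lam i)%N.
Hypothesis mu_nondec : forall i j : 'I_n, (i <= j)%N -> (mu i <= mu j)%N.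
Hypothesis mu_ge : forall i : 'I_n, (i <= mu i)%N.

(** The shape contains [(r, j)] because [mu r <= mu i <= j < lam i <= lam r]. For [r < i], the chain
    [r < i <= mu i <= j] makes [x_r x_j] squarefree; as [x_r] divides the label of [(r, c)] and
    [x_j] that of [(i, j)], the product divides any common multiple of the two. *)
Lemma first_row_dominates (b : 'X_{1..m}) (r i : 'I_n) (c j : 'I_m) : (r <= i)%N ->
    (r, c) \in Y -> (label (r, c) <= b)%MM ->
    (i, j) \in Y -> (label (i, j) <= b)%MM ->
  (r, j) \in Y /\ (label (r, j) <= b)%MM.
Proof.
rewrite leq_eqVlt => /predU1P[/val_inj->|lt_ri] //.
rewrite !inE /= => /andP[_ _] /mnm_lepP le_rc /andP[le_ij lt_ji] /mnm_lepP le_ij_b.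
rewrite (leq_trans (mu_nondec (ltnW lt_ri))) //.
rewrite (leq_trans lt_ji) ?lam_noninc ?(ltnW lt_ri) //; split=> //.
have ne_rj : widen_ord le_nm r != j.
  by rewrite -val_eqE /= ltn_eqF // (leq_trans lt_ri) // (leq_trans (mu_ge i)).
apply/mnm_lepP=> k; rewrite specialized_labelE /=.
have:= le_rc k; have:= le_ij_b k; rewrite !specialized_labelE /=.
have [<-|_] := eqVneq (widen_ord le_nm r) k.
  by rewrite [j == _]eq_sym (negPf ne_rj) addn0 => _; apply: leq_trans (leq_addr _ _).
by rewrite add0n => le_k _; apply: leq_trans le_k; apply: leq_addl.
Qed.

Variables (K : fieldType) (eps : {set 'I_n * 'I_m} -> {set 'I_n * 'I_m} -> int).
Hypothesis epsP : incidence_function X eps.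

Lemma ferrers_strand_acyclic b : strand_acyclic X K label eps b.
Proof.
move=> k z zP dz.
(* A nonzero [z] is what makes [W] nonempty: its support contains a face of positive rank, hence one
   with a vertex. *)
have [P zP0|z0] := pickP (fun P => z P != 0); last first.
  exists (fun=> 0) => P; first by rewrite eqxx.
  by rewrite big1 => [|Q _]; [apply/eqP/negbFE | rewrite mul0r].
pose W := [set v in Y | (label v <= b)%MM].
have sWY : W \subset Y by apply/subsetP=> v /setIdP[].
have inW Q : Q \in face X -> (face_label label Q <= b)%MM = (Q \subset W).
  rewrite face_induced => /andP[_ sQY]; rewrite face_label_le.
  apply/forall_inP/subsetP=> [le_b v vQ|sQW v /sQW/setIdP[] //].
  by apply/setIdP; rewrite (subsetP sQY) ?le_b.
have [v0 v0W] : exists v, v \in W.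
  have [PX leP rkP] := zP _ zP0.
  have /set0Pn[v vP] : P != set0 by rewrite -ferrers_rank_gt0 rkP.
  by exists v; rewrite inW // in leP; apply: (subsetP leP).
have [[r c] Wrc minr] := @arg_minnP _ v0 (mem W) (fun v => v.1) v0W.
have [|v vW|P' Q||P' /zP[PX leP rkP]||w wP wE] :=
    @dominated_acyclic K n m Y W (scalar_boundary X K eps) k.+1 r c z sWY.
- exact: Wrc.
- have /setIdP[vY vb] := vW; have /setIdP[rcY rcb] := Wrc.
  have := minr _ vW; case: v vY vb {vW} => i j ijY ijb /= le_ri.
  exact/setIdP/(first_row_dominates le_ri rcY rcb ijY ijb).
- exact: scalar_boundary_neq0.
- exact: scalar_boundary2.
- by split=> //; rewrite -inW.
- exact: dz.
by exists w => // P' /wP[PX PW rkP]; split=> //; rewrite inW.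
Qed.

End FerrersComplex.

Theorem theorem3p12 (K : fieldType) (n m : nat)
  (n_ge1 : (1 <= n)%N) (le_nm : (n <= m)%N)
  (lam mu : 'I_n -> nat)
  (lam_first : forall i : 'I_n, nat_of_ord i = 0%N -> lam i = m)
  (lam_noninc : forall i j : 'I_n, (i <= j)%N -> (lam j <= lam i)%N)
  (lam_last_pos : forall i : 'I_n, i.+1 = n -> (1 <= lam i)%N)
  (mu_nondec : forall i j : 'I_n, (i <= j)%N -> (mu i <= mu j)%N)
  (mu_lt_lam_last : forall i : 'I_n, i.+1 = n -> (mu i < lam i)%N)
  (mu_ge : forall i : 'I_n, (i <= mu i)%N)
  (eps : {set 'I_n * 'I_m} -> {set 'I_n * 'I_m} -> int)
  (eps_incidence : incidence_function (ferrers_complex m lam mu) eps) :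
  minimal_graded_free_resolution
    (cellular_complex (ferrers_complex m lam mu) K (specialized_label le_nm) eps)
    (@specialized_ideal K n m lam mu le_nm).
Proof.
split.
- exact: cellular_complex_graded.
- apply: cellular_complex_acyclic => // [b|Q].
    exact: ferrers_strand_acyclic.
  rewrite inE => /andP[_ /eqP rk0]; apply/eqP/negbNE.
  by rewrite -(ferrers_rank_gt0 lam mu) rk0.
- move=> f; rewrite -specialized_idealE; apply: cellular_complex_image => //.
  + exact: ferrers_face0.
  + by rewrite frank_induced !imset0 !cards0.
  + exact: ferrers_rank1.
by apply: cellular_complex_minimal => // P Q; apply: ferrers_label_neq.
Qed.
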